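(* Let $a,b,c>0$ be real numbers, $r\ge1$ an integer and $k_1,\dots,k_r$ integers. For every integer $n\ge0$ and all $x,y$, $$E^{(k_1,\ldots,k_r)}_{n}(x+y;a,b,c)=\sum_{i=0}^n\binom{n}{i}(r\ln c)^{n-i}E^{(k_1,\ldots,k_r)}_{i}(x;a,b,c)\,y^{n-i}.$$
   Context: For integers $k_1,\dots,k_r$, the multiple polylogarithm is the formal power series ${\rm Li}_{(k_1,\ldots,k_r)}(z)=\sum_{0< m_1< m_2<\cdots< m_r}\frac{z^{m_r}}{m_1^{k_1}m_2^{k_2}\cdots m_r^{k_r}}$. For real $a,b,c>0$, $a^{-t}$ means $e^{-t\ln a}$, etc. The generalized multi poly-Euler polynomials are defined by $$\frac{2\,{\rm Li}_{(k_1,\ldots,k_r)}\big(1-(ab)^{-t}\big)}{(a^{-t}+b^{t})^r}\,c^{rxt}=\sum_{n=0}^{\infty}E^{(k_1,\ldots,k_r)}_n(x;a,b,c)\frac{t^n}{n!}.$$ *)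

(* Defs.v *)
From HB Require Import structures.
From mathcomp Require Import all_boot all_order all_algebra.
From mathcomp Require Import reals exp.

Set Implicit Arguments.
Unset Strict Implicit.
Unset Printing Implicit Defensive.

Import Order.TTheory GRing.Theory Num.Theory.
Local Open Scope ring_scope.

(* A formal power series is its coefficient sequence: f stands for
   \sum_n (f n) t^n. *)
Definition fps (K : fieldType) := nat -> K.

Section FormalPowerSeries.
Variable K : fieldType.
Implicit Types f g : fps K.

Definition fps_one : fps K := fun n => (n == 0%N)%:R.

Definition fps_add f g : fps K := fun n => f n + g n.

Definition fps_sub f g : fps K := fun n => f n - g n.

Definition fps_scale (u : K) f : fps K := fun n => u * f n.

Definition fps_mul f g : fps K := fun n => \sum_(i < n.+1) f i * g (n - i)%N.

Definition fps_pow f (m : nat) : fps K := iter m (fps_mul f) fps_one.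

(* fps_inv_seq f n lists the coefficients 0, ..., n of 1 / f, obtained by
   solving f * g = 1 for g coefficient by coefficient. *)
Fixpoint fps_inv_seq f (n : nat) : seq K :=
  if n is m.+1 then
    let s := fps_inv_seq f m in
    rcons s (- (f 0%N)^-1 * \sum_(i < m.+1) f i.+1 * s`_(m - i))
  else [:: (f 0%N)^-1].

(* Only meaningful when f 0 != 0; see fps_mulfV. *)
Definition fps_inv f : fps K := fun n => (fps_inv_seq f n)`_n.

Definition fps_div f g : fps K := fps_mul f (fps_inv g).

(* The composite f(g(t)), only meaningful when g 0 = 0: the powers g^m with
   m > n then do not contribute to the coefficient of t^n; see fps_pow_eq0. *)
Definition fps_comp f g : fps K :=
  fun n => \sum_(m < n.+1) f m * fps_pow g m n.

(* e^(u t) *)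
Definition fps_exp (u : K) : fps K := fun n => u ^+ n / n`!%:R.

Lemma size_fps_inv_seq f n : size (fps_inv_seq f n) = n.+1.
Proof. by elim: n => //= n IHn; rewrite size_rcons IHn. Qed.

Lemma nth_fps_inv_seq f n i :
  (i <= n)%N -> (fps_inv_seq f n)`_i = fps_inv f i.
Proof.
elim: n => [|n IHn]; first by rewrite leqn0 => /eqP->.
rewrite leq_eqVlt ltnS => /predU1P[-> //|le_in].
by rewrite /= nth_rcons size_fps_inv_seq ltnS le_in IHn.
Qed.

Lemma fps_mulfV f : f 0%N != 0 -> fps_mul f (fps_inv f) =1 fps_one.
Proof.
move=> f0 [|n]; first by rewrite /fps_mul big_ord1 /fps_inv /= mulfV.
rewrite /fps_mul big_ord_recl /= subn0 {1}/fps_inv /= nth_rcons.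
rewrite size_fps_inv_seq ltnn eqxx mulNr mulrN mulVKf // addrC.
apply/eqP; rewrite subr_eq0; apply/eqP/eq_bigr => i _.
by rewrite /bump /= add1n subSS nth_fps_inv_seq // leq_subr.
Qed.

Lemma fps_pow_eq0 g m n : g 0%N = 0 -> (n < m)%N -> fps_pow g m n = 0.
Proof.
move=> g0; elim: m n => // m IHm n; rewrite ltnS => le_nm.
rewrite /fps_pow iterS -/(fps_pow g m) /fps_mul big1 // => -[[|i] /= lt_i] _.
  by rewrite g0 mul0r.
by rewrite IHm ?mulr0 //; apply: leq_trans le_nm; rewrite ltn_subrL; case: n lt_i.
Qed.

(* The coefficient of z^m is the sum over all (m_1, ..., m_r) with
   0 < m_1 < ... < m_r = m; all entries are thus < m.+1. *)
Definition multi_polylog r (k : r.-tuple int) : fps K :=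
  fun m => \sum_(s : r.-tuple 'I_m.+1 |
                  path ltn 0%N (map val s) && (last 0%N (map val s) == m))
             \prod_(i < r) ((tnth s i : nat)%:R ^ tnth k i)^-1.

End FormalPowerSeries.

(* The values of the polynomials in x are taken in a field K containing the
   reals through iota, e.g. K = R with iota = idfun, or K = R[i] with
   iota = real_complex R. *)
Section MultiPolyEuler.
Variables (R : realType) (K : fieldType) (iota : {rmorphism R -> K}).

(* d^(v t) = e^(v t ln d) for a real d > 0 *)
Definition fps_rpow (d : R) (v : K) : fps K := fps_exp (v * iota (ln d)).

Definition multi_poly_euler_gf r (k : r.-tuple int) (x : K) (a b c : R)
    : fps K :=
  fps_mul
    (fps_div
       (fps_scale 2
          (fps_comp (multi_polylog K k)
                    (fps_sub (fps_one K) (fps_rpow (a * b) (-1)))))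
       (fps_pow (fps_add (fps_rpow a (-1)) (fps_rpow b 1)) r))
    (fps_rpow c (r%:R * x)).

Definition multi_poly_euler r (k : r.-tuple int) (n : nat) (x : K)
    (a b c : R) : K :=
  n`!%:R * multi_poly_euler_gf k x a b c n.

End MultiPolyEuler.

(* Main.v *)
Require Import Defs.
From mathcomp Require Import all_boot all_order all_algebra.
From mathcomp Require Import reals exp.
From mathcomp Require Import ring.
Import GRing.Theory Num.Theory.
Local Open Scope ring_scope.

(** The variable x enters the generating function only through the factor
    c^(r x t) = e^(r x t ln c), so replacing x by x + y multiplies it by
    e^(r y t ln c). Comparing coefficients of t^n / n! gives the identity. *)

(** Coefficient [m] of a product involves only coefficients up to [m], so truncation at [N > m] is
    harmless. *)
Lemma coefM_poly_fps (K : fieldType) (f g : fps K) (N m : nat) :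
  (m < N)%N ->
  ((\poly_(i < N) f i) * (\poly_(i < N) g i))`_m = fps_mul f g m.
Proof.
move=> ltmN; rewrite coefM; apply: eq_bigr => i _; rewrite !coef_poly.
have lt_iN : (i < N)%N := leq_trans (ltn_ord i) ltmN.
by rewrite lt_iN (leq_ltn_trans (leq_subr i m) ltmN).
Qed.

(** Inherited from polynomials by truncating all three series after degree [n]. *)
Lemma fps_mulA (K : fieldType) (f g h : fps K) :
  fps_mul f (fps_mul g h) =1 fps_mul (fps_mul f g) h.
Proof.
move=> n; pose P (u : fps K) := \poly_(i < n.+1) u i.
transitivity ((P f * (P g * P h))`_n).
  rewrite coefM; apply: eq_bigr => i _.
  by rewrite coefM_poly_fps ?ltnS ?leq_subr // coef_poly ltn_ord.
rewrite mulrA coefM; apply: eq_bigr => i _.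
by rewrite coefM_poly_fps // coef_poly ltnS leq_subr.
Qed.

(** [iota] is injective, so [K] has characteristic 0 and factorials are invertible in it. *)
Lemma natf_neq0_rmorph (R : numFieldType) (K : fieldType)
    (iota : {rmorphism R -> K}) (n : nat) :
  (n%:R != 0 :> K) = (n != 0%N).
Proof. by rewrite -(rmorph_nat iota) fmorph_eq0 pnatr_eq0. Qed.

Lemma fps_expD (K : fieldType) (u v : K) :
  (forall n, n`!%:R != 0 :> K) ->
  fps_exp (u + v) =1 fps_mul (fps_exp u) (fps_exp v).
Proof.
(* [exprDn] gives the exponent [n - i] to the first summand; the swap gives [i] to [u], as in the
   convolution. *)
move=> fact_neq0 n; rewrite /fps_exp addrC exprDn mulr_suml.
apply: eq_bigr => i _.
have le_in : (i <= n)%N by rewrite -ltnS.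
rewrite -(bin_fact le_in) !natrM -mulr_natr.
have Cn0 : 'C(n, i)%:R != 0 :> K.
  by have := fact_neq0 n; rewrite -(bin_fact le_in) natrM mulf_eq0 => /norP[].
by field; rewrite Cn0 !fact_neq0.
Qed.

Theorem theorem3p2 (R : realType) (K : fieldType) (iota : {rmorphism R -> K})
    (a b c : R) (ha : 0 < a) (hb : 0 < b) (hc : 0 < c)
    (r : nat) (hr : (1 <= r)%N) (k : r.-tuple int) (n : nat) (x y : K) :
  multi_poly_euler iota k n (x + y) a b c =
  \sum_(i < n.+1)
    'C(n, i)%:R * (r%:R * iota (ln c)) ^+ (n - i)
      * multi_poly_euler iota k i x a b c * y ^+ (n - i).
Proof.
have fact_neq0 m : m`!%:R != 0 :> K.
  by rewrite (natf_neq0_rmorph _ _ iota) -lt0n fact_gt0.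
have gfD : multi_poly_euler_gf iota k (x + y) a b c n =
    fps_mul (multi_poly_euler_gf iota k x a b c)
      (fps_exp (r%:R * y * iota (ln c))) n.
  (* Associativity brings the two exponentials together; the other factor is free of [x]. *)
  rewrite {2}/multi_poly_euler_gf -fps_mulA; apply: eq_bigr => i _.
  by congr (_ * _); rewrite /fps_rpow -fps_expD // mulrDr mulrDl.
rewrite /multi_poly_euler gfD /fps_mul mulr_sumr; apply: eq_bigr => i _.
have le_in : (i <= n)%N by rewrite -ltnS.
(* In [n! = 'C(n, i) * (i! * (n - i)!)], [i!] normalizes the [i]-th polynomial and [(n - i)!]
   cancels the denominator of the exponential. *)
rewrite -(bin_fact le_in) !natrM /fps_exp [r%:R * y * _]mulrAC exprMn.
by field.
Qed.
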